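(* Let $a,b_1,b_2,c$ be constants with $b_2\neq 0$, and let $G(x)=G^{2,4}(x,a,b_1,b_2,c)$ be the unique formal power series solution of \[ G(x)=\frac{a}{1+b_1x+b_2x^2+cx^4G(x)}. \] If $H_n(G)\neq 0$ for all $n\ge 0$, then for all $n\ge1$ \begin{align*} H_{2n+1}(G) =& b_2 a^{2n+1} (ac)^{n^2} B_{n-1}\left(\frac{ac}{b_2}, \frac{2ac+b_2^2}{b_2}, -\frac{ac}{b_2}\right),\\ H_{2n}(G)=&(-1)^nb_2a^{2n}(ac)^{n(n-1)} B_{n-1}\left(\frac{ac}{b_2}, \frac{2ac+b_2^2}{b_2}, -\frac{ac}{b_2}\right). \end{align*}
   Context: $G^{2,4}$ is the (weighted) generating function of lattice paths with steps $(1,0),(2,0),(3,1),(-1,1)$ of weights $b_1,b_2,c,1$ that stay weakly above and return to the $x$-axis (times $a$); it is characterized by the functional equation above. For a formal power series $A(x)=\sum_{n\ge0}a_nx^n$, $H_n(A(x))=\det(a_{i+j})_{0\le i,j\le n-1}$, with $H_0(A(x))=1$. For constants $a',c',d'$, the sequence $B_n(a',c',d')$ is defined by $B_0=1$, $B_1=c'-a'$, and $B_{n+1}=\beta B_n+\alpha B_{n-1}$ for $n\ge1$, where $\alpha=a'(c'+d'-a')$ and $\beta=c'-2a'$. *)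

(* Defs.v *)
(* MathComp *)
From mathcomp Require Import all_boot all_order all_algebra.

Set Implicit Arguments.
Unset Strict Implicit.
Unset Printing Implicit Defensive.

Import GRing.Theory.
Local Open Scope ring_scope.

(* A formal power series is its coefficient sequence; equality of series is
   pointwise equality [=1]. *)
Definition fps (F : fieldType) := nat -> F.

Section FormalPowerSeries.
Variable F : fieldType.
Implicit Types (u v w : fps F) (p : {poly F}) (n : nat).

Definition fps_of_poly p : fps F := fun n => p`_n.

Definition fps_add u v : fps F := fun n => u n + v n.

Definition fps_mul u v : fps F := fun n => \sum_(i < n.+1) u i * v (n - i)%N.

(* [fps_inv_prefix u n] lists the first [n] coefficients of the reciprocal of
   [u]; the recursion solves [fps_mul u v =1 1] for the last coefficient [v n].
   The result is meaningful only when [u 0 != 0] (see [fps_mulV]). *)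
Fixpoint fps_inv_prefix u n : seq F :=
  if n is m.+1 then
    let s := fps_inv_prefix u m in
    rcons s ((u 0)^-1 * ((m == 0)%:R - \sum_(i < m) u (m - i)%N * s`_i))
  else [::].

Definition fps_inv u : fps F := fun n => (fps_inv_prefix u n.+1)`_n.

Definition fps_div u v : fps F := fps_mul u (fps_inv v).

Definition hankel_det u n : F := \det (\matrix_(i < n, j < n) u (i + j)%N).

Definition G24_denom (b1 b2 c : F) (G : fps F) : fps F :=
  fps_add (fps_of_poly (1 + b1 *: 'X + b2 *: 'X^2))
          (fps_mul (fps_of_poly (c *: 'X^4)) G).

Definition G24_eqn (a b1 b2 c : F) (G : fps F) : Prop :=
  G =1 fps_div (fps_of_poly a%:P) (G24_denom b1 b2 c G).

Fixpoint hankel_B (a' c' d' : F) n : F :=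
  match n with
  | 0 => 1
  | 1 => c' - a'
  | (m.+1 as k).+1 =>
      (c' - 2%:R * a') * hankel_B a' c' d' k
      + a' * (c' + d' - a') * hankel_B a' c' d' m
  end.

Lemma size_fps_inv_prefix u n : size (fps_inv_prefix u n) = n.
Proof. by elim: n => //= n IHn; rewrite size_rcons IHn. Qed.

Lemma nth_fps_inv_prefix u n i :
  (i < n)%N -> (fps_inv_prefix u n)`_i = fps_inv u i.
Proof.
elim: n => // n IHn; rewrite ltnS leq_eqVlt => /orP[/eqP -> //|lt_in].
by rewrite /= nth_rcons size_fps_inv_prefix lt_in IHn.
Qed.

Lemma fps_invE u n :
  fps_inv u n =
    (u 0)^-1 * ((n == 0)%:R - \sum_(i < n) u (n - i)%N * fps_inv u i).
Proof.
rewrite {1}/fps_inv /= nth_rcons size_fps_inv_prefix ltnn eqxx.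
by congr (_ * (_ - _)); apply: eq_bigr => i _; rewrite nth_fps_inv_prefix.
Qed.

Lemma fps_mulV u : u 0 != 0 -> fps_mul u (fps_inv u) =1 fps_of_poly 1.
Proof.
move=> u0 n; rewrite /fps_mul /fps_of_poly coef1 big_ord_recl /= subn0.
rewrite {1}fps_invE mulrA mulfV // mul1r.
rewrite [X in _ - X + _](_ : _ = \sum_(i < n) u (lift ord0 i) *
                                   fps_inv u (n - lift ord0 i)%N) ?subrK //.
rewrite (reindex_inj rev_ord_inj) /=; apply: eq_bigr => i _.
by rewrite /bump /= add1n subKn.
Qed.

Let agree n u v := forall k, (k < n)%N -> u k = v k.

Let fps_inv_agree n u v : agree n u v -> agree n (fps_inv u) (fps_inv v).
Proof.
move=> uv k; have [m] := ubnP k; elim: m k => // m IHm k lekm ltkn.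
rewrite !fps_invE (uv 0) ?(leq_ltn_trans _ ltkn) //; congr (_ * (_ - _)).
apply: eq_bigr => i _; rewrite (uv (k - i)%N) ?(leq_ltn_trans (leq_subr _ _)) //.
by congr (_ * _); apply: IHm; [apply: leq_trans (ltn_ord i) _ | apply: ltn_trans ltkn].
Qed.

Let G24_rhs (a b1 b2 c : F) G : fps F :=
  fps_div (fps_of_poly a%:P) (G24_denom b1 b2 c G).

Let G24_rhs_agree a b1 b2 c n u v :
  agree n u v -> agree n.+1 (G24_rhs a b1 b2 c u) (G24_rhs a b1 b2 c v).
Proof.
move=> uv k ltkn; apply: eq_bigr => i _; congr (_ * _).
apply: (@fps_inv_agree n.+1); last exact: leq_ltn_trans (leq_subr _ _) ltkn.
move=> {i ltkn}k ltkn; congr (_ + _); apply: eq_bigr => i _.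
rewrite /fps_of_poly coefZ coefXn; case: eqP => [i4|]; last by rewrite mulr0 !mul0r.
congr (_ * _); apply: uv.
have := ltn_ord i; rewrite i4 => lt4k.
rewrite -ltnS; apply: leq_trans ltkn; rewrite ltnS.
by rewrite ltn_subrL; case: (k) lt4k.
Qed.

Lemma G24_eqn_exists a b1 b2 c : exists G, G24_eqn a b1 b2 c G.
Proof.
pose Phi := G24_rhs a b1 b2 c; pose z n := iter n Phi (fun=> 0).
have zS m : agree m (z m) (z m.+1).
  by elim: m => // m IHm; apply: G24_rhs_agree.
have zD m d : agree m (z m) (z (m + d)%N).
  elim: d => [|d IHd] k ltkm; first by rewrite addn0.
  by rewrite IHd // addnS zS // (leq_trans ltkm) ?leq_addr.
exists (fun n => z n.+1 n) => n.
apply: (@G24_rhs_agree a b1 b2 c n) => // k ltkn.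
by rewrite (zD k.+1 (n - k.+1)%N) // subnKC.
Qed.

Lemma G24_eqn_unique a b1 b2 c G1 G2 :
  G24_eqn a b1 b2 c G1 -> G24_eqn a b1 b2 c G2 -> G1 =1 G2.
Proof.
move=> eq1 eq2 n; suff: agree n.+1 G1 G2 by apply.
elim: n.+1 => // m IHm k ltkm; rewrite eq1 eq2.
exact: (@G24_rhs_agree a b1 b2 c m).
Qed.

End FormalPowerSeries.

(* Main.v *)
(** The J-fraction of [G] can be written down explicitly.  If
    [f (1 + u x - x^2 g) = f(0)], then [H_{n+1}(f) = f(0)^{n+1} H_n(g)]; for
    [f = G] this gives [g = L(b2)] with [L(t) = - (t + c x^2 G)].  Two further
    steps lead from [L(t)] through [c G / (t + c x^2 G)] to [L(b2 + a c / t)].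
    Writing [t = q / p], the pair [(p, q)] becomes [(q, b2 q + a c p)], which is
    the linear recurrence defining [B_n]. *)
Require Import Defs.
From mathcomp Require Import all_boot all_order all_algebra.
From Stdlib Require Import Ring FunctionalExtensionality.

Import GRing.Theory.
Local Open Scope ring_scope.

(** * The commutative ring of formal power series *)

Section PowerSeriesRing.
Variable F : fieldType.
Implicit Types (u v w : fps F) (p q : {poly F}) (n k : nat).

Definition fps_opp u : fps F := fun n => - u n.
Definition fps_sub u v : fps F := fun n => u n - v n.
Definition fps0 : fps F := fun _ => 0.
Definition fps1 : fps F := fps_of_poly 1.

Definition fps_trunc n u : {poly F} := \poly_(i < n) u i.

Lemma coef_fps_trunc n u k : (k < n)%N -> (fps_trunc n u)`_k = u k.
Proof. by move=> lt_kn; rewrite coef_poly lt_kn. Qed.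

Lemma coefM_agree n p p' q q' :
    (forall k, (k < n)%N -> p`_k = p'`_k) ->
    (forall k, (k < n)%N -> q`_k = q'`_k) ->
  forall k, (k < n)%N -> (p * q)`_k = (p' * q')`_k.
Proof.
move=> eq_p eq_q k lt_kn; rewrite !coefM; apply: eq_bigr => i _.
rewrite eq_p ?eq_q // ?(leq_ltn_trans (leq_subr _ _)) //.
by rewrite (leq_trans (ltn_ord i)).
Qed.

(** Coefficient [k] of a product involves only coefficients of index at most [k], so truncations
    compute it. This carries commutativity and associativity over from [{poly F}]. *)
Lemma fps_mul_coefM n u v p q :
    (forall k, (k < n)%N -> p`_k = u k) ->
    (forall k, (k < n)%N -> q`_k = v k) ->
  forall k, (k < n)%N -> fps_mul u v k = (p * q)`_k.
Proof.
move=> eq_p eq_q k lt_kn; rewrite coefM; apply: eq_bigr => i _.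
rewrite eq_p ?eq_q // ?(leq_ltn_trans (leq_subr _ _)) //.
by rewrite (leq_trans (ltn_ord i)).
Qed.

Lemma fps_mulC u v : fps_mul u v = fps_mul v u.
Proof.
apply: functional_extensionality => n.
have tr w k : (k < n.+1)%N -> (fps_trunc n.+1 w)`_k = w k.
  exact: coef_fps_trunc.
by rewrite (fps_mul_coefM _ _ _ _ _ (tr u) (tr v)) // mulrC
           -(fps_mul_coefM _ _ _ _ _ (tr v) (tr u)).
Qed.

Lemma fps_mulA u v w : fps_mul u (fps_mul v w) = fps_mul (fps_mul u v) w.
Proof.
apply: functional_extensionality => n.
have tr x k : (k < n.+1)%N -> (fps_trunc n.+1 x)`_k = x k.
  exact: coef_fps_trunc.
have trM x y k : (k < n.+1)%N ->
    (fps_trunc n.+1 x * fps_trunc n.+1 y)`_k = fps_mul x y k.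
  by move=> lt_kn; rewrite (fps_mul_coefM _ _ _ _ _ (tr x) (tr y)).
by rewrite (fps_mul_coefM _ _ _ _ _ (tr u) (trM v w)) // mulrA
           -(fps_mul_coefM _ _ _ _ _ (trM u v) (tr w)).
Qed.

Lemma fps_of_polyM p q :
  fps_of_poly (p * q) = fps_mul (fps_of_poly p) (fps_of_poly q).
Proof. by apply: functional_extensionality => n; rewrite /fps_of_poly coefM. Qed.

Lemma fps_of_polyD p q :
  fps_of_poly (p + q) = fps_add (fps_of_poly p) (fps_of_poly q).
Proof. by apply: functional_extensionality => n; rewrite /fps_of_poly coefD. Qed.

Lemma fps_mulDl u v w :
  fps_mul (fps_add u v) w = fps_add (fps_mul u w) (fps_mul v w).
Proof.
apply: functional_extensionality => n; rewrite /fps_mul /fps_add -big_split.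
by apply: eq_bigr => i _; rewrite mulrDl.
Qed.

Lemma fps_mul1 u : fps_mul fps1 u = u.
Proof.
apply: functional_extensionality => n.
rewrite /fps_mul big_ord_recl big1 /= /fps1 /fps_of_poly.
  by rewrite coef1 mul1r subn0 addr0.
by move=> i _; rewrite coef1 mul0r.
Qed.

(** Stated for Leibniz equality, by functional extensionality, so that [ring] can decide identities
    between series. *)
Lemma fps_ring_theory :
  ring_theory fps0 fps1 (@fps_add F) (@fps_mul F) fps_sub fps_opp eq.
Proof.
split.
- by move=> u; apply: functional_extensionality => n; apply: add0r.
- by move=> u v; apply: functional_extensionality => n; apply: addrC.
- by move=> u v w; apply: functional_extensionality => n; apply: addrA.
- exact: fps_mul1.
- exact: fps_mulC.
- exact: fps_mulA.
- exact: fps_mulDl.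
- by [].
- by move=> u; apply: functional_extensionality => n; apply: addrN.
Qed.

End PowerSeriesRing.

Arguments fps_opp {F}.
Arguments fps_sub {F}.
Arguments fps1 {F}.

(** * Hankel determinants under one step of a J-fraction *)

Section JFraction.
Variable F : fieldType.
Implicit Types (u f g : fps F) (n : nat).

Add Ring fps_ring : (fps_ring_theory F).

Local Notation "u +s v" := (fps_add u v) (at level 50, left associativity).
Local Notation "u *s v" := (fps_mul u v) (at level 40, left associativity).
Local Notation cst x := (fps_of_poly (polyC x)).
Local Notation x := (fps_of_poly 'X).

Lemma fps_mulX u n : (x *s u) n = if n is m.+1 then u m else 0.
Proof.
rewrite /fps_mul /fps_of_poly big_ord_recl coefX mul0r add0r.
case: n => [|n]; first by rewrite big_ord0.
rewrite big_ord_recl coefX mul1r big1 ?addr0 ?subn1 // => i _.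
by rewrite coefX mul0r.
Qed.

Lemma fps_mulc (s : F) u n : (cst s *s u) n = s * u n.
Proof.
rewrite /fps_mul /fps_of_poly big_ord_recl coefC subn0 big1 ?addr0 // => i _.
by rewrite coefC mul0r.
Qed.

Lemma hankel_det0 f : hankel_det f 0 = 1.
Proof. exact: det_mx00. Qed.

Lemma hankel_det1 f : hankel_det f 1 = f 0.
Proof. by rewrite /hankel_det det_mx11 mxE. Qed.

(* With [T] and [U] the lower and upper triangular Toeplitz matrices of [d]
   and [f], the convolution identity says [T * Hankel f = (1 (+) Hankel g) * U]. *)
Lemma hankel_det_conv f g (d : nat -> F) n :
    d 0 = 1 -> (forall m, d m.+2 = - g m) ->
    (forall k, \sum_(i < k.+2) f i * d (k.+1 - i)%N = 0) ->
  hankel_det f n.+1 = f 0 ^+ n.+1 * hankel_det g n.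
Proof.
move=> d0 dS conv.
pose T := \matrix_(i < n.+1, j < n.+1) if (j <= i)%N then d (i - j)%N else 0.
pose U := \matrix_(i < n.+1, j < n.+1) if (i <= j)%N then f (j - i)%N else 0.
pose M : 'M_(1 + n) := block_mx 1%:M 0 0 (\matrix_(i < n, j < n) g (i + j)%N).
have detT : \det T = 1.
  rewrite det_trig; last by apply/is_trig_mxP => i j lt_ij; rewrite mxE leqNgt lt_ij.
  by rewrite big1 // => i _; rewrite mxE leqnn subnn.
have detU : \det U = f 0 ^+ n.+1.
  rewrite -det_tr det_trig; last first.
    by apply/is_trig_mxP => i j lt_ij; rewrite !mxE leqNgt lt_ij.
  rewrite (eq_bigr (fun=> f 0)) ?prodr_const ?card_ord // => i _.
  by rewrite !mxE leqnn subnn.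
have detM : \det M = hankel_det g n by rewrite det_ublock det1 mul1r.
suff TH : T *m (\matrix_(i < n.+1, j < n.+1) f (i + j)%N) = M *m U.
  by rewrite -[LHS]mul1r -detT /hankel_det -det_mulmx TH det_mulmx detM detU mulrC.
have M0 j : M ord0 j = (j == 0 :> nat)%:R.
  rewrite -[ord0](lshift0 n 0) -[j]splitK; case: (split j) => k /=.
    by rewrite (block_mxEul (1%:M : 'M_1)) mxE !ord1.
  by rewrite (block_mxEur (1%:M : 'M_1)) mxE.
have MS0 (i : 'I_n) : M (lift ord0 i) ord0 = 0.
  by rewrite -rshift1 -[X in M _ X](lshift0 n 0) (block_mxEdl (1%:M : 'M_1)) mxE.
have MSS (i j : 'I_n) : M (lift ord0 i) (lift ord0 j) = g (i + j)%N.
  by rewrite -!rshift1 (block_mxEdr (1%:M : 'M_1)) mxE.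
apply/matrixP => i j; rewrite !mxE; case: (unliftP ord0 i) => [i' ->|->].
  rewrite [RHS]big_ord_recl MS0 mul0r add0r.
  under eq_bigr do rewrite !mxE lift0.
  under [RHS]eq_bigr do rewrite MSS mxE lift0.
  have -> : \sum_(k < n.+1) (if (k <= i'.+1)%N then d (i'.+1 - k)%N else 0) * f (k + j)%N =
            \sum_(k < i'.+2) d (i'.+1 - k)%N * f (j + k)%N.
    rewrite (big_ord_widen n.+1 (fun k => d (i'.+1 - k)%N * f (j + k)%N)) ?ltnS //.
    rewrite [RHS]big_mkcond; apply: eq_bigr => k _; rewrite ltnS addnC.
    by case: ifP => // _; rewrite mul0r.
  have -> : \sum_(k < n) g (i' + k)%N * (if (k < j)%N then f (j - k.+1)%N else 0) =
            \sum_(k < j) g (i' + k)%N * f (j - k.+1)%N.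
    rewrite (big_ord_widen n (fun k => g (i' + k)%N * f (j - k.+1)%N)) ?leq_ord //.
    rewrite [RHS]big_mkcond; apply: eq_bigr => k _.
    by case: ifP => // _; rewrite mulr0.
  (* Cut this convolution at index [j]. The terms from [j] on form the entry of [T] times the Hankel
     matrix; those below [j] involve [d] only at indices at least 2, where it is [- g], and form the
     entry of [M *m U]. *)
  have := conv (i' + j)%N.
  rewrite (_ : (i' + j).+2 = j + i'.+2)%N; last by rewrite addnC !addnS.
  rewrite big_split_ord /= (reindex_inj rev_ord_inj) /= => /eqP.
  rewrite addrC addr_eq0 -sumrN => /eqP conv_ij.
  transitivity (\sum_(k < i'.+2) f (j + k)%N * d ((i' + j).+1 - (j + k))%N).
    by apply: eq_bigr => k _; rewrite mulrC -addSn [(i'.+1 + j)%N]addnC subnDl.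
  rewrite conv_ij; apply: eq_bigr => k _.
  have -> : ((i' + j).+1 - (j - k.+1) = (i' + k).+2)%N.
    by rewrite -{1}(subnKC (ltn_ord k)) addnA -addSn addnK addnS.
  by rewrite dS mulrN opprK mulrC.
rewrite !big_ord_recl !big1 ?addr0 => [|k _|k _]; rewrite ?M0 !mxE //=.
- by rewrite d0 subn0.
- by rewrite mul0r.
- by rewrite mul0r.
Qed.

(** The sequence [d] of [hankel_det_conv] is the denominator: its constant term is 1, from degree 2
    on it is [- g] shifted, and all positive-degree coefficients of [f *s d] vanish because the
    product is constant. *)
Lemma hankel_det_jstep f g (s u : F) n :
    f *s (fps_sub (fps1 +s cst u *s x) (x *s x *s g)) = cst s ->
  hankel_det f n.+1 = s ^+ n.+1 * hankel_det g n.
Proof.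
set d := fps_sub _ _ => fd.
have xx m : (x *s x *s g) m = if m is k.+2 then g k else 0.
  by rewrite -fps_mulA fps_mulX; case: m => // m; rewrite fps_mulX.
have d0 : d 0 = 1.
  by rewrite /d /fps_sub /fps_add xx fps_mulc /fps1 /fps_of_poly coefX coef1 mulr0 subr0 addr0.
have f0 : f 0 = s.
  have := congr1 (fun h : fps F => h 0) fd.
  by rewrite /fps_mul big_ord1 d0 mulr1 /fps_of_poly coefC.
rewrite -f0; apply: (hankel_det_conv _ _ d) => // [m|k].
  by rewrite /d /fps_sub /fps_add xx fps_mulc /fps1 /fps_of_poly coefX coef1 mulr0 addr0 sub0r.
have := congr1 (fun h : fps F => h k.+1) fd.
by rewrite /fps_of_poly coefC.
Qed.

End JFraction.

(** * The J-fraction steps of [G] *)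

Section G24.
Variables (F : fieldType) (a b1 b2 c : F) (G : fps F).
Hypothesis GE : G24_eqn a b1 b2 c G.

Add Ring fps_ring_G24 : (fps_ring_theory F).

Local Notation "u +s v" := (fps_add u v) (at level 50, left associativity).
Local Notation "u *s v" := (fps_mul u v) (at level 40, left associativity).
Local Notation cst x := (fps_of_poly (polyC x)).
Local Notation x := (fps_of_poly 'X).
Local Notation tail t := (cst t +s cst c *s x *s x *s G).
Local Notation H t := (hankel_det (fps_opp (tail t))).

Lemma cst0 : cst (0 : F) = fps0 F.
Proof. by apply: functional_extensionality => n; rewrite /fps_of_poly coefC if_same. Qed.

Lemma cstN (s : F) : cst (- s) = fps_opp (cst s).
Proof. by apply: functional_extensionality => n; rewrite /fps_of_poly polyCN coefN. Qed.

Lemma cstM (s t : F) : cst (s * t) = cst s *s cst t.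
Proof. by rewrite polyCM fps_of_polyM. Qed.

Lemma cstD (s t : F) : cst (s + t) = cst s +s cst t.
Proof. by rewrite polyCD fps_of_polyD. Qed.

Lemma fps_mul_invr (u : fps F) : u 0 != 0 -> u *s fps_inv u = fps1.
Proof. by move=> u0; apply: functional_extensionality; apply: fps_mulV. Qed.

Lemma tail0 t : (tail t) 0 = t.
Proof.
rewrite /fps_add -!fps_mulA fps_mulc fps_mulX mulr0 addr0.
by rewrite /fps_of_poly coefC.
Qed.

Lemma G24_mul_denom :
  G *s (fps1 +s cst b1 *s x +s x *s x *s tail b2) = cst a.
Proof.
have dE : G24_denom b1 b2 c G = fps1 +s cst b1 *s x +s x *s x *s tail b2.
  rewrite /G24_denom -!mul_polyC !exprS expr0 mulr1.
  by rewrite !fps_of_polyD !fps_of_polyM -/fps1; ring.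
(* The constant term is 1, so [fps_inv] is a genuine reciprocal. *)
have d0 : G24_denom b1 b2 c G 0 != 0.
  rewrite dE /fps_add -!fps_mulA fps_mulc !fps_mulX /fps1 /fps_of_poly.
  by rewrite coef1 coefX mulr0 !addr0 oner_neq0.
rewrite -dE; have GE' := functional_extensionality _ _ GE.
rewrite [X in X *s _]GE' /fps_div -fps_mulA (fps_mulC _ (fps_inv _)) fps_mul_invr //.
by rewrite fps_mulC fps_mul1.
Qed.

(** With the denominator grouped as [1 + b1 x + x^2 (b2 + c x^2 G)], the functional equation is
    itself a J-fraction step. *)
Lemma hankel_det_G24 n : hankel_det G n.+1 = a ^+ n.+1 * H b2 n.
Proof. by apply: (hankel_det_jstep _ _ _ _ b1); rewrite -G24_mul_denom; ring. Qed.

(** Two J-fraction steps: from [- tail t] to [c G / tail t] with constant [- t], then to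
    [- tail (b2 + r)] with constant [r = a c / t]. *)
Lemma hankel_det_tail t n : t != 0 ->
  H t n.+2 = (- t) ^+ n.+2 * (a * c / t) ^+ n.+1 * H (b2 + a * c / t) n.
Proof.
move=> t0; set r := a * c / t.
have [g gt] : exists g, g *s tail t = fps1.
  by exists (fps_inv (tail t)); rewrite fps_mulC fps_mul_invr // tail0.
have rt : cst r *s cst t = cst a *s cst c by rewrite -!cstM /r divfK.
have tail_r : tail (b2 + r) = tail b2 +s cst r by rewrite cstD; ring.
rewrite (hankel_det_jstep _ _ (cst c *s G *s g) (- t) 0); last first.
  have -> : cst (- t) = fps_opp (tail t) +s
                        cst c *s x *s x *s G *s (g *s tail t).
    by rewrite gt cstN; ring.
  by rewrite cst0; ring.
rewrite (hankel_det_jstep _ _ (fps_opp (tail (b2 + r))) r b1) ?mulrA // tail_r.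
(* The shift of [b2] by [r] adds [r c x^2 G g] to [a c g]; since [a c = r t], the sum is
   [r g tail t = r]. *)
transitivity (cst r *s (g *s tail t)); last by rewrite gt; ring.
transitivity (cst c *s g *s (G *s (fps1 +s cst b1 *s x +s x *s x *s tail b2))
              +s cst c *s G *s g *s x *s x *s cst r); first ring.
rewrite G24_mul_denom.
transitivity (g *s (cst a *s cst c) +s cst c *s G *s g *s x *s x *s cst r); first ring.
by rewrite -rt; ring.
Qed.

End G24.

From mathcomp Require Import ring.

(** * The linear recurrence behind [hankel_B] *)

Section Recurrence.
Variable F : fieldType.
Variables b s : F.

(** The recursion moves the initial pair, matching what [hankel_det_tail] does to the denominator
    and numerator of [t = q / p]. *)
Fixpoint lin_rec (p q : F) n : F :=
  if n is m.+1 then lin_rec q (b * q + s * p) m else p.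

Lemma lin_recSS p q n :
  lin_rec p q n.+2 = b * lin_rec p q n.+1 + s * lin_rec p q n.
Proof. by elim: n p q => // n IHn p q; rewrite -[LHS]/(lin_rec _ _ n.+2) IHn. Qed.

(** For these parameters [c' - 2a' = b] and [a'(c' + d' - a') = s], so both sides obey the same
    recurrence; the initial values are [b] and [b^2 + s]. *)
Lemma hankel_B_lin_rec n : b != 0 ->
  b * hankel_B (s / b) ((2%:R * s + b ^+ 2) / b) (- (s / b)) n = lin_rec 1 b n.+1.
Proof.
move=> b0; set B := hankel_B _ _ _.
suff: b * B n = lin_rec 1 b n.+1 /\ b * B n.+1 = lin_rec 1 b n.+2 by case.
elim: n => [|n [IHn IHn1]]; first by rewrite /B /=; split; field.
split=> //; rewrite lin_recSS -IHn -IHn1.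
rewrite -[B n.+2]/((_ - _) * B n.+1 + _ * (_ + _ - _) * B n).
by field.
Qed.

End Recurrence.

Arguments lin_rec {F}.

(** * Iterating the double step *)

Section HankelG24.
Variables (F : fieldType) (a b1 b2 c : F) (G : fps F).
Hypothesis GE : G24_eqn a b1 b2 c G.

Local Notation H t := (hankel_det (fps_opp (fps_add (fps_of_poly t%:P)
  (fps_mul (fps_mul (fps_mul (fps_of_poly c%:P) (fps_of_poly 'X)) (fps_of_poly 'X)) G)))).

(** Induction on [n] for all pairs [p], [q] at once, since each double step replaces them by [q] and
    [b2 q + a c p]. The factor [p] clears the denominator of [t]. *)
Lemma hankel_det_tail_lin_rec n p q :
    p != 0 -> (forall m, H (q / p) m != 0) ->
  p * H (q / p) (2 * n)%N = (a * c) ^+ (n ^ 2)%N * lin_rec b2 (a * c) p q n /\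
  p * H (q / p) (2 * n).+1 =
    (- 1) ^+ n.+1 * (a * c) ^+ (n * n.+1)%N * lin_rec b2 (a * c) p q n.+1.
Proof.
elim: n p q => [|n IHn] p q p0 Hn0.
  rewrite hankel_det0 hankel_det1 /fps_opp tail0 /=.
  by rewrite !expr0 mul1r mulr1 expr1 mulr1 mulrN mulrCA divff // mulr1 mulN1r.
(* The order-one determinant is [- q / p], so its nonvanishing permits the next division. *)
have q0 : q != 0.
  apply: contra_neq (Hn0 1%N) => ->.
  by rewrite hankel_det1 /fps_opp tail0 mul0r oppr0.
have t0 : q / p != 0 by rewrite mulf_neq0 ?invr_neq0.
have step := fun m => hankel_det_tail _ _ _ _ _ _ GE _ m t0.
have next : b2 + a * c / (q / p) = (b2 * q + a * c * p) / q.
  by field; rewrite p0 q0.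
rewrite next in step.
have Hn0' m : H ((b2 * q + a * c * p) / q) m != 0.
  by have := Hn0 m.+2; rewrite step mulf_eq0 negb_or => /andP[].
have [even odd] := IHn _ _ q0 Hn0'.
(* Each [a c / t] pairs with one [- t]; the single [- t] left over turns the prefactor [p] into
   [- q]. *)
have prod : - (q / p) * (a * c / (q / p)) = - (a * c) by field; rewrite p0 q0.
have stepE m : p * H (q / p) m.+2 =
    (- 1) ^+ m * (a * c) ^+ m.+1 * (q * H ((b2 * q + a * c * p) / q) m).
  rewrite step exprS -[_ * _ * _ ^+ _]mulrA -exprMn prod (exprNn (a * c)) (exprS (- 1)).
  by set h := hankel_det _ _; field.
rewrite mulnS !addSn add0n.
split.
  rewrite stepE even exprM sqrrN !expr1n mul1r mulrA -exprD.
  by congr (_ ^+ _ * _); ring.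
rewrite stepE odd exprS exprM sqrrN !expr1n.
have -> : (n.+1 * n.+2 = (2 * n).+2 + n * n.+1)%N by ring.
rewrite exprD (exprS _ n.+1) -[lin_rec _ _ p q _]/(lin_rec _ _ q _ n.+1).
by set l := lin_rec _ _ _ _ _; ring.
Qed.

End HankelG24.

(** * Closed forms for odd and even order *)

Theorem theorem2 (F : fieldType) (a b1 b2 c : F) (G : fps F)
    (hb2 : b2 != 0)
    (hG : G24_eqn a b1 b2 c G)
    (hH : forall n : nat, hankel_det G n != 0) :
  forall n : nat, (1 <= n)%N ->
    hankel_det G (2 * n + 1)%N =
      b2 * a ^+ (2 * n + 1)%N * (a * c) ^+ (n ^ 2)%N
      * hankel_B (a * c / b2) ((2%:R * a * c + b2 ^+ 2) / b2) (- (a * c / b2)) (n - 1)%N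
    /\
    hankel_det G (2 * n)%N =
      (- 1) ^+ n * b2 * a ^+ (2 * n)%N * (a * c) ^+ (n * (n - 1))%N
      * hankel_B (a * c / b2) ((2%:R * a * c + b2 ^+ 2) / b2) (- (a * c / b2)) (n - 1)%N.
Proof.
(* The iteration starts from [p = 1], [q = b2]; these determinants are factors of those of [G]. *)
have H0 m : hankel_det (fps_opp (fps_add (fps_of_poly (b2 / 1)%:P)
    (fps_mul (fps_mul (fps_mul (fps_of_poly c%:P) (fps_of_poly 'X))
                      (fps_of_poly 'X)) G))) m != 0.
  have := hH m.+1; rewrite (hankel_det_G24 _ _ _ _ _ _ hG) divr1 mulf_eq0 negb_or.
  by case/andP.
case=> // n _; rewrite subn1 /=.
(* Passing from [G] to its tail lowers the order by one and so swaps parity. Even order at [n.+1]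
   and odd order at [n] both end at the term [lin_rec] of index [n.+1], that is [b2] times [B_n]. *)
have [even _] := hankel_det_tail_lin_rec _ _ _ _ _ _ hG n.+1 _ _ (oner_neq0 F) H0.
have [_ odd] := hankel_det_tail_lin_rec _ _ _ _ _ _ hG n _ _ (oner_neq0 F) H0.
rewrite !mul1r !divr1 in even odd.
have B := hankel_B_lin_rec _ _ (a * c) n hb2; rewrite mulrA in B.
split.
  rewrite addn1 (hankel_det_G24 _ _ _ _ _ _ hG) even -B.
  by rewrite -2![RHS]mulrA !(mulrCA _ b2).
rewrite mulnS (hankel_det_G24 _ _ _ _ _ _ hG) -[(2 + _)%N]/(_.+2) odd -B (mulnC n.+1).
by ring.
Qed.
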